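(* Let $\ell\ge1$ and let $\alpha=\alpha_1\alpha_2\cdots\alpha_{\ell+1}\in\{\textsc{i},\textsc{o}\}^{\ell+1}$ be a signature with $\alpha_1=\textsc{o}$. Then the $\alpha$-assocoipahedron is realized by a face of the pebble tree polytope $\mathbb{PTP}_\ell^{1,0}$: there is a face $F$ of $\mathbb{PTP}_\ell^{1,0}$ such that the poset of nonempty faces of $F$, ordered by reverse inclusion, is isomorphic to the contraction poset on $\alpha$-trees.
   Context: **$\alpha$-trees.** For $\alpha\in\{\textsc{i},\textsc{o}\}^{\ell+1}$ with $\alpha_1=\textsc{o}$, an $\alpha$-tree is a rooted oriented planar tree with $\ell+1$ external arrows (the first being the root arrow) such that: labeling the external arrows counterclockwise starting from the root, the $i$th external arrow is incoming if $\alpha_i=\textsc{i}$ and outgoing if $\alpha_i=\textsc{o}$; each internal node has at least two incident arrows, at least one of which is outgoing; and no internal node has precisely one incoming and one outgoing arrow. (For $\ell=1$ and $\alpha=\textsc{oi}$, the single arrow with no internal node counts as the unique $\alpha$-tree.) Contracting an internal arrow of an $\alpha$-tree gives an $\alpha$-tree; the contraction poset on $\alpha$-trees has $t'\le t$ if $t'$ is obtained from $t$ by contracting internal arrows. The $\alpha$-assocoipahedron is the polytopal complex, due to Poirier and Tradler, whose faces are encoded by the contraction poset on $\alpha$-trees. **Pebble trees with one color.** An ordered tree is either a leaf or a node with a nonempty ordered list of subtrees (its children). A subtree of $T$ is the full tree rooted at a node or leaf of $T$ (including $T$ itself). Leaves are numbered $1,\dots,\ell$ from left to right. $\mathcal{P}_\ell^{1,0}$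 is the set of ordered trees $T$ with $\ell$ leaves and with finitely many indistinguishable pebbles placed on their nodes (none on leaves, at least one on each node with a single child, arbitrarily many, possibly none, on other nodes), such that for each subtree $S$ the number of leaves minus the number of pebbles of $S$ is $0$ ($S$ is balanced) or $1$ ($S$ is unbalanced), and $T$ itself is balanced. **Pebble tree polytope.** For a subtree $S$ with leaves $[s,t]\subseteq[\ell]$, let $\lambda(S)=[s,t-1]$ if $S$ is unbalanced and $\lambda(S)=[s,t-1]\cup[\ell+s-1,\ell+t-1]$ if $S$ is balanced. Let $I=[1,2\ell-1]$, $\mathbb{H}=\{\mathbf{x}\in\mathbb{R}^I:\sum_{i\in I}x_i=0\}$ and, for $J\subseteq I$, $\mathbf{r}_J=|I\setminus J|\sum_{j\in J}\mathbf{e}_j-|J|\sum_{j\in I\setminus J}\mathbf{e}_j\in\mathbb{H}$. The pebble tree fan $\mathcal{PF}_\ell^{1,0}$ is the collection of cones $\mathbb{C}(T)$, $T\in\mathcal{P}_\ell^{1,0}$, where $\mathbb{C}(T)$ is the nonnegative span of the vectors $\mathbf{r}_{\lambda(S)}$ for all subtrees $S$ of $T$. The pebble tree polytope $\mathbb{PTP}_\ell^{1,0}$ denotes any polytope in $\mathbb{H}$ whose normal fan (outer normals, i.e. normal cone of a face $F$ = linear forms maximized on $F$) is $\mathcal{PF}_\ell^{1,0}$; such polytopes exist. *)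

(* Defs.v *)
From Stdlib Require Export Relation_Operators.
From mathcomp Require Export all_boot all_order all_algebra.
From mathcomp Require Export classical_sets functions reals.

Set Implicit Arguments.
Unset Strict Implicit.
Unset Printing Implicit Defensive.

Import Order.TTheory GRing.Theory Num.Theory.

Local Open Scope classical_set_scope.
Local Open Scope ring_scope.

(** * Oriented planar trees *)

Inductive io : Type := Inc | Out.

Definition is_inc (a : io) : bool := if a is Inc then true else false.
Definition is_out (a : io) : bool := if a is Out then true else false.

Inductive heading : Type := ToRoot | FromRoot.

(** A rooted oriented planar tree is stored together with the arrow at its top,
    which leads towards the root; for the whole tree this is the root arrow.
    [Arrow h] is an arrow with no internal node below it, i.e. an external arrow
    of the ambient tree (or, on its own, the tree without internal node).
    The children of a node are listed counterclockwise from its top arrow. *)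
Inductive otree : Type :=
  | Arrow of heading
  | Node of heading & seq otree.

Definition top_arrow (t : otree) : heading :=
  match t with Arrow h => h | Node h _ => h end.

(** An arrow joins an upper end (closer to the root) to a lower end; whether it
    is outgoing or incoming depends on the end from which it is seen. *)
Definition from_lower_end (h : heading) : io := if h is ToRoot then Out else Inc.
Definition from_upper_end (h : heading) : io := if h is ToRoot then Inc else Out.

Fixpoint leaf_arrows (t : otree) : seq heading :=
  match t with
  | Arrow h => [:: h]
  | Node _ cs => flatten (map leaf_arrows cs)
  end.

(** Incoming or outgoing is with respect to the tree, so that the root arrow is
    seen from its lower end and the other external arrows from their upper end.
    In particular [Arrow ToRoot] has external arrows [:: Out; Inc]. *)
Definition external_arrows (t : otree) : seq io :=
  from_lower_end (top_arrow t) :: map from_upper_end (leaf_arrows t).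

Definition incident_arrows (h : heading) (cs : seq otree) : seq io :=
  from_lower_end h :: map (fun c => from_upper_end (top_arrow c)) cs.

Definition admissible_node (s : seq io) : bool :=
  [&& (2 <= size s)%N, (1 <= count is_out s)%N &
      ~~ ((count is_inc s == 1%N) && (count is_out s == 1%N))].

Fixpoint admissible_nodes (t : otree) : bool :=
  match t with
  | Arrow _ => true
  | Node h cs => admissible_node (incident_arrows h cs) && all admissible_nodes cs
  end.

Definition alpha_tree (alpha : seq io) (t : otree) : Prop :=
  external_arrows t = alpha /\ admissible_nodes t.

Inductive contract1 : otree -> otree -> Prop :=
  | contract_here h l h' cs r :
      contract1 (Node h (l ++ Node h' cs :: r)) (Node h (l ++ cs ++ r))
  | contract_below h l c c' r :
      contract1 c c' -> contract1 (Node h (l ++ c :: r)) (Node h (l ++ c' :: r)).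

Definition contraction_le (t' t : otree) : Prop :=
  clos_refl_trans otree contract1 t t'.

(** * Pebble trees with one color *)

(** [PNode k cs] carries [k] pebbles. *)
Inductive ptree : Type :=
  | PLeaf
  | PNode of nat & seq ptree.

Fixpoint nb_leaves (T : ptree) : nat :=
  match T with PLeaf => 1 | PNode _ cs => sumn (map nb_leaves cs) end.

Fixpoint nb_pebbles (T : ptree) : nat :=
  match T with PLeaf => 0 | PNode k cs => (k + sumn (map nb_pebbles cs))%N end.

Definition balanced (S : ptree) : bool := nb_leaves S == nb_pebbles S.
Definition unbalanced (S : ptree) : bool := nb_leaves S == (nb_pebbles S).+1.

(** The subtrees of [T] with multiplicity, each paired with the number of its
    leftmost leaf, when the leaves of [T] are numbered from [s]. *)
Fixpoint subtrees (s : nat) (T : ptree) : seq (nat * ptree) :=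
  (s, T) ::
  match T with
  | PLeaf => [::]
  | PNode _ cs =>
      (fix forest (s : nat) (cs : seq ptree) : seq (nat * ptree) :=
         match cs with
         | [::] => [::]
         | c :: cs' => subtrees s c ++ forest (s + nb_leaves c)%N cs'
         end) s cs
  end.

Definition pebble_node_ok (S : ptree) : bool :=
  match S with
  | PLeaf => true
  | PNode k cs => (1 <= size cs)%N && ((size cs == 1%N) ==> (1 <= k)%N)
  end.

Definition pebble_tree (l : nat) (T : ptree) : bool :=
  [&& nb_leaves T == l,
      all (fun sS => pebble_node_ok sS.2 && (balanced sS.2 || unbalanced sS.2))
          (subtrees 1 T)
    & balanced T].

(** * Polytopes, faces and normal fans *)

Section Polytopes.
Variables (R : realType) (n : nat).
Implicit Types (P F : set 'rV[R]_n) (c x y : 'rV[R]_n) (vs : seq 'rV[R]_n).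

Definition dot c x : R := \sum_(i < n) c ord0 i * x ord0 i.

Definition convex_hull vs : set 'rV[R]_n :=
  [set x | exists a : 'I_(size vs) -> R,
     [/\ forall k, 0 <= a k, \sum_k a k = 1 & x = \sum_k a k *: vs`_k]].

Definition conic_hull vs : set 'rV[R]_n :=
  [set x | exists a : 'I_(size vs) -> R,
     (forall k, 0 <= a k) /\ x = \sum_k a k *: vs`_k].

Definition is_polytope P : Prop := exists vs, P = convex_hull vs.

(** Faces are cut out by valid inequalities; the empty set is a face. *)
Definition is_face P F : Prop :=
  exists (c : 'rV[R]_n) (b : R),
    (forall x, P x -> dot c x <= b) /\ F = [set x | P x /\ dot c x = b].

Definition nonempty_faces P : set (set 'rV[R]_n) :=
  [set F | is_face P F /\ F !=set0].

Definition sum_zero : set 'rV[R]_n := [set x | \sum_(i < n) x ord0 i = 0].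

(** Linear forms on [sum_zero] are represented by elements of [sum_zero] through
    the standard inner product. *)
Definition normal_cone P F : set 'rV[R]_n :=
  [set c | sum_zero c /\ forall x y, F x -> P y -> dot c y <= dot c x].

Definition normal_fan P : set (set 'rV[R]_n) :=
  normal_cone P @` nonempty_faces P.

Definition ray (J : {set 'I_n}) : 'rV[R]_n :=
  #|~: J|%:R *: (\sum_(j in J) delta_mx 0 j)
  - #|J|%:R *: (\sum_(j in ~: J) delta_mx 0 j).

End Polytopes.

(** * The pebble tree fan and polytopes *)

(** The index set [1, 2l-1] is represented by ordinals, [j] standing for [j.+1]. *)
Definition lambda (l : nat) (sS : nat * ptree) : {set 'I_(2 * l).-1} :=
  let s := sS.1 in
  let t := (s + nb_leaves sS.2).-1 in
  [set j : 'I_(2 * l).-1 |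
     (s <= j.+1 <= t.-1)%N
     || (balanced sS.2 && (l + s - 1 <= j.+1 <= l + t - 1)%N)].

Definition pebble_cone (R : realType) (l : nat) (T : ptree) :
    set 'rV[R]_(2 * l).-1 :=
  conic_hull [seq ray R (lambda l sS) | sS <- subtrees 1 T].
Arguments pebble_cone : clear implicits.

Definition pebble_tree_fan (R : realType) (l : nat) :
    set (set 'rV[R]_(2 * l).-1) :=
  pebble_cone R l @` [set T | pebble_tree l T].
Arguments pebble_tree_fan : clear implicits.

Definition pebble_tree_polytope (R : realType) (l : nat)
    (P : set 'rV[R]_(2 * l).-1) : Prop :=
  [/\ is_polytope P, P `<=` @sum_zero R (2 * l).-1 & normal_fan P = pebble_tree_fan R l].
Arguments pebble_tree_polytope {R} l P.

Definition order_isomorphic (X Y : Type)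
    (A : set X) (leX : X -> X -> Prop) (B : set Y) (leY : Y -> Y -> Prop) : Prop :=
  exists f : X -> Y, set_bij A B f /\
    forall x x', A x -> A x' -> (leX x x' <-> leY (f x) (f x')).

(* Main.v *)
Require Import Defs.
From mathcomp Require Import zify ring lra boolp.

Set Implicit Arguments.
Unset Strict Implicit.
Unset Printing Implicit Defensive.

(** The map from a face to its normal cone reverses inclusion, and a face of a face
    is a face. So the faces of the face [F] whose normal cone is the cone of a pebble
    tree [T0] are encoded by the pebble trees [T] whose cone contains that of [T0].
    A subtree enters its cone only through its descriptor (first leaf, number of
    leaves, balanced or not), and containment of pebble cones turns out to be
    containment of the sets of descriptors: if [ray J] lies in the cone of [T], then
    [J] is a union of sets [lambda S], and laminarity of the leaf intervals forces
    [J] to be one of them.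

    An alpha-tree becomes a pebble tree by reading an arrow heading to the root as
    "balanced" and an arrow heading away from it as "unbalanced", the number of pebbles
    of each node being then determined; an incoming external arrow becomes a leaf below
    a node with one pebble. Taking for [T0] the image of the corolla, the pebble trees
    above [T0] are the images of the alpha-trees, and contraction is containment of
    descriptors. *)

(** * Descriptors of pebble trees *)

Definition desc : Type := (nat * nat * bool)%type.
Definition first (d : desc) : nat := d.1.1.
Definition width (d : desc) : nat := d.1.2.
Definition bal (d : desc) : bool := d.2.

Definition descriptor (sS : nat * ptree) : desc :=
  (sS.1, nb_leaves sS.2, balanced sS.2).

Definition descs (s : nat) (T : ptree) : seq desc := map descriptor (subtrees s T).

Fixpoint forest_descs (s : nat) (cs : seq ptree) : seq desc :=
  if cs is c :: cs' then descs s c ++ forest_descs (s + nb_leaves c) cs' else [::].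

Lemma descs_node s k cs :
  descs s (PNode k cs) =
  (s, sumn (map nb_leaves cs), balanced (PNode k cs)) :: forest_descs s cs.
Proof.
rewrite /descs /=; congr cons.
by elim: cs s => //= c cs IH s; rewrite map_cat IH.
Qed.

(** The generated principle gives no hypothesis on trees inside a list. Children are indexed by
    position because their leaf offsets depend on it. *)
Lemma ptree_nested_ind (Q : ptree -> Prop) :
  Q PLeaf ->
  (forall k cs, (forall i, i < size cs -> Q (nth PLeaf cs i)) -> Q (PNode k cs)) ->
  forall T, Q T.
Proof.
move=> QL QN; fix IH 1 => -[|k cs]; first exact: QL.
apply: QN; elim: cs => [|c cs IHcs]; first by clear IH.
by case=> [_|i Hi]; [exact: IH | exact: IHcs].
Qed.

(** The local conditions of [pebble_tree] in recursive form, without the conditions on the number of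
    leaves and on the balance of the whole tree. *)
Fixpoint wf (T : ptree) : bool :=
  match T with
  | PLeaf => true
  | PNode k cs => [&& pebble_node_ok T, balanced T || unbalanced T & all wf cs]
  end.

Lemma all_subtrees_wf s T :
  all (fun sS => pebble_node_ok sS.2 && (balanced sS.2 || unbalanced sS.2))
    (subtrees s T) = wf T.
Proof.
elim/ptree_nested_ind: T s => [|k cs IH] s //=.
rewrite -andbA; congr [&& _, _ & _].
elim: cs s IH => //= c cs IHcs s IH.
rewrite all_cat (IH 0) // IHcs // => i Hi s'; exact: (IH i.+1).
Qed.

Lemma wf_excess T : wf T -> nb_leaves T = nb_pebbles T + ~~ balanced T.
Proof.
case: T => [|k cs] // /and3P [_ /orP [] H _]; first by rewrite H addn0 (eqP H).
move: H; rewrite /unbalanced /balanced => /eqP ->; lia.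
Qed.

Lemma wf_children k cs i :
  wf (PNode k cs) -> i < size cs -> wf (nth PLeaf cs i).
Proof. by move=> /and3P [_ _ /all_nthP H]; apply: H. Qed.

Lemma wf_nb_leaves_gt0 T : wf T -> 0 < nb_leaves T.
Proof.
elim/ptree_nested_ind: T => [|k cs IH] // H.
case: cs IH H => [|c cs] IH H; first by case/and3P: H.
by rewrite /= addn_gt0 (IH 0) // (wf_children H (i := 0)).
Qed.

Definition offset (cs : seq ptree) (i : nat) : nat :=
  sumn (map nb_leaves (take i cs)).

Lemma offset_lt cs i j : i < j <= size cs ->
  offset cs i + nb_leaves (nth PLeaf cs i) <= offset cs j.
Proof.
move=> /andP [ij js]; rewrite /offset.
elim: cs i j ij js => [|c cs IH] [|i] [|j] //= ij js.
  by rewrite add0n leq_addr.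
by rewrite -addnA leq_add2l IH.
Qed.

Lemma offset_size cs : offset cs (size cs) = sumn (map nb_leaves cs).
Proof. by rewrite /offset take_size. Qed.

Lemma forest_descsP s cs d :
  reflect (exists2 i, i < size cs & d \in descs (s + offset cs i) (nth PLeaf cs i))
          (d \in forest_descs s cs).
Proof.
elim: cs s => [|c cs IH] s /=; first by constructor=> -[].
rewrite mem_cat; apply: (iffP orP) => [[H|/IH [i Hi H]]|[[|i] Hi H]].
- by exists 0 => //=; rewrite addn0.
- by exists i.+1 => //=; rewrite /offset /= addnA.
- by left; rewrite /= addn0 in H.
- by right; apply/IH; exists i; move: H; rewrite /offset //= addnA.
Qed.

Lemma mem_descs_root s T : (s, nb_leaves T, balanced T) \in descs s T.
Proof. by case: T => [|k cs]; rewrite ?descs_node inE eqxx. Qed.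

Lemma descs_bounds s T d : wf T -> d \in descs s T ->
  [/\ s <= first d, 0 < width d & first d + width d <= s + nb_leaves T].
Proof.
elim/ptree_nested_ind: T s d => [|k cs IH] s d H.
  by rewrite inE => /eqP ->.
rewrite descs_node inE => /predU1P [->|/forest_descsP [i Hi Hd]].
  by split=> //; apply: (wf_nb_leaves_gt0 H).
have [A B C] := IH i Hi _ _ (wf_children H Hi) Hd.
have := @offset_lt cs i (size cs); rewrite offset_size Hi leqnn => /(_ isT) /= O.
split=> //; lia.
Qed.

Lemma child_bounds s k cs i d : wf (PNode k cs) -> i < size cs ->
  d \in descs (s + offset cs i) (nth PLeaf cs i) ->
  [/\ s + offset cs i <= first d, 0 < width d &
      first d + width d <= s + offset cs i + nb_leaves (nth PLeaf cs i)].
Proof. move=> H Hi; apply: descs_bounds; exact: wf_children H Hi. Qed.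

Definition has_leaf (d : desc) (i : nat) : bool := first d <= i < first d + width d.

Definition within (d d' : desc) : bool :=
  (first d' <= first d) && (first d + width d <= first d' + width d').

Lemma descs_cases s k cs d : wf (PNode k cs) -> d \in descs s (PNode k cs) ->
  d = (s, sumn (map nb_leaves cs), balanced (PNode k cs)) \/
  exists2 i, i < size cs & d \in descs (s + offset cs i) (nth PLeaf cs i).
Proof.
by move=> H; rewrite descs_node inE => /predU1P [->|/forest_descsP Hd]; [left|right].
Qed.

(** Distinct children have disjoint leaf intervals, so the common leaf [i] puts both descriptors in
    the same child unless one of them is the root. *)
Lemma descs_laminar s T d d' i : wf T -> d \in descs s T -> d' \in descs s T ->
  has_leaf d i -> has_leaf d' i -> within d d' || within d' d.
Proof.
elim/ptree_nested_ind: T s => [|k cs IH] s H.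
  by rewrite !inE => /eqP -> /eqP ->; rewrite /within !leqnn.
move=> Hd Hd'; have [A B C] := descs_bounds H Hd; have [A' B' C'] := descs_bounds H Hd'.
have [E|[j Hj Hdj]] := descs_cases H Hd.
  by move: A' C'; rewrite E /within /first /width /=; lia.
have [E|[j' Hj' Hdj']] := descs_cases H Hd'.
  by move: A C; rewrite E /within /first /width /=; lia.
have [e|Hne] := eqVneq j j'.
  by subst j'; apply: (IH j Hj _ (wf_children H Hj)) Hdj Hdj'.
have [_ _ U] := child_bounds H Hj Hdj; have [V _ W] := child_bounds H Hj' Hdj'.
have [V2 _ _] := child_bounds H Hj Hdj.
rewrite /has_leaf; have [L|L] := ltnP j j'.
  have := @offset_lt cs j j'; rewrite L (ltnW Hj') => /(_ isT); lia.
have := @offset_lt cs j' j; rewrite (ltnW Hj) ltn_neqAle eq_sym Hne L => /(_ isT); lia.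
Qed.

(** Each unbalanced child contributes one leaf in excess of its pebbles, and the [k] pebbles of the
    node absorb all of these except the excess of the node itself. Hence the balances determine
    [k]. *)
Lemma node_excess k cs : wf (PNode k cs) ->
  count (predC balanced) cs = k + ~~ balanced (PNode k cs).
Proof.
move=> H; have := wf_excess H; rewrite /=.
have: all wf cs by case/and3P: H.
suff S : all wf cs -> sumn (map nb_leaves cs) =
   sumn (map nb_pebbles cs) + count (predC balanced) cs by move=> /S ->; lia.
elim: cs {H} => //= c cs IH /andP [Hc /IH ->].
rewrite (wf_excess Hc); lia.
Qed.

Lemma unbalanced_child k cs : wf (PNode k cs) -> ~~ balanced (PNode k cs) ->
  exists2 i, i < size cs & ~~ balanced (nth PLeaf cs i).
Proof.
move=> H U; have := node_excess H; rewrite U addn1 => E.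
have/(has_nthP PLeaf) [i Hi Hb] : has (predC balanced) cs by rewrite has_count E.
by exists i.
Qed.

(* The walk from an unbalanced node down through unbalanced children ends at a leaf. *)
Lemma unbalanced_leaf s T : wf T -> ~~ balanced T ->
  exists2 i, s <= i < s + nb_leaves T &
    forall d, d \in descs s T -> bal d -> ~~ has_leaf d i.
Proof.
elim/ptree_nested_ind: T s => [|k cs IH] s H U.
  by exists s; rewrite ?leqnn ?addn1 //= => d; rewrite inE => /eqP ->.
have [j Hj Uj] := unbalanced_child H U.
have [i Hi Hd] := IH j Hj (s + offset cs j) (wf_children H Hj) Uj.
have := @offset_lt cs j (size cs); rewrite offset_size Hj leqnn => /(_ isT) /= O.
exists i; first by lia.
move=> d /(descs_cases H) [-> /=|[j' Hj' Hdj'] Bd].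
  by rewrite /bal /= (negbTE U).
have [e|Hne] := eqVneq j j'; first by subst j'; apply: Hd.
have [V _ W] := child_bounds H Hj' Hdj'.
rewrite /has_leaf; have [L|L] := ltnP j j'.
  have := @offset_lt cs j j'; rewrite L (ltnW Hj') => /(_ isT); lia.
have := @offset_lt cs j' j; rewrite (ltnW Hj) ltn_neqAle eq_sym Hne L => /(_ isT); lia.
Qed.

(** Take the leaf that [unbalanced_leaf] finds in the subtree of [d]: no balanced subtree inside has
    it, so a balanced descriptor with this leaf comes from higher up. *)
Lemma unbalanced_desc_leaf s T d : wf T -> d \in descs s T -> ~~ bal d ->
  exists2 i, has_leaf d i &
    forall d', d' \in descs s T -> bal d' -> has_leaf d' i -> within d d'.
Proof.
elim/ptree_nested_ind: T s => [|k cs IH] s H Hd U.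
  move: Hd; rewrite inE => /eqP E; exists s; first by rewrite E /has_leaf /first /width /=; lia.
  by move=> d'; rewrite inE => /eqP ->.
have [A B C] := descs_bounds H Hd.
have [E|[j Hj Hdj]] := descs_cases H Hd.
  have Ub : ~~ balanced (PNode k cs) by move: U; rewrite E.
  have [i Hi Hn] := unbalanced_leaf s H Ub.
  exists i; first by rewrite /has_leaf E.
  by move=> d' Hd' Bd'; rewrite (negbTE (Hn d' Hd' Bd')).
have [i Hi Hn] := IH j Hj (s + offset cs j) (wf_children H Hj) Hdj U.
exists i => // d' Hd' Bd' Li.
have [E|[j' Hj' Hdj']] := descs_cases H Hd'.
  by move: A C; rewrite E /within /first /width /=; lia.
have [e|Hne] := eqVneq j j'; first by subst j'; apply: Hn.
have [V1 _ W1] := child_bounds H Hj Hdj.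
have [V _ W] := child_bounds H Hj' Hdj'.
move: Hi Li; rewrite /has_leaf; have [L|L] := ltnP j j'.
  have := @offset_lt cs j j'; rewrite L (ltnW Hj') => /(_ isT); lia.
have := @offset_lt cs j' j; rewrite (ltnW Hj) ltn_neqAle eq_sym Hne L => /(_ isT); lia.
Qed.

Lemma mem_descs_leaf s T i : wf T -> s <= i < s + nb_leaves T ->
  (i, 1, false) \in descs s T.
Proof.
elim/ptree_nested_ind: T s => [|k cs IH] s H Hi.
  have -> : i = s by move: Hi => /=; lia.
  by rewrite inE.
rewrite descs_node inE; apply/orP; right.
have: forall j, j < size cs -> forall s, wf (nth PLeaf cs j) ->
    s <= i < s + nb_leaves (nth PLeaf cs j) ->
    (i, 1, false) \in descs s (nth PLeaf cs j) by move=> j Hj s'; apply: IH.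
have: all wf cs by case/and3P: H.
move: Hi => /=; elim: cs s {IH H} => [|c cs IHc] s /=; first by lia.
move=> Hi /andP [Wc Wcs] IH; rewrite mem_cat.
have [L|L] := ltnP i (s + nb_leaves c).
  have Hc : s <= i < s + nb_leaves c by lia.
  by rewrite (IH 0 _ s Wc Hc).
rewrite IHc ?orbT //; first lia.
by move=> j Hj; apply: (IH j.+1).
Qed.

(** An index [x < l] stands for the gap between leaves [x] and [x + 1], and the index [l + i - 1]
    for leaf [i]. So a descriptor covers its inner gaps and, if balanced, its leaves. Successors
    avoid truncated subtraction. *)
Definition lamn (l : nat) (d : desc) (x : nat) : bool :=
  ((first d <= x) && (x.+1 < first d + width d))
  || (bal d && ((l + first d <= x.+1) && (x.+1 < l + first d + width d))).

(** If the root has two children or more, the gap between the first two is covered by the root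
    alone. If it has one child, its pebbles force that child to be unbalanced, and the leaf given by
    [unbalanced_leaf] lies in no balanced subtree of the child. *)
Lemma root_private_index l T : wf T -> balanced T -> nb_leaves T = l ->
  exists2 x, 0 < x < 2 * l &
    forall d, d \in descs 1 T -> d != (1, l, true) -> ~~ lamn l d x.
Proof.
case: T => [|k cs] // H B E.
have Lp := wf_nb_leaves_gt0 H.
have Edesc : (1, sumn (map nb_leaves cs), balanced (PNode k cs)) = (1, l, true).
  by rewrite B -E.
case: cs H B E Lp Edesc => [|c [|c' cs]] H B E Lp Edesc; first by case/and3P: H.
  have K : 0 < k by case/and3P: H.
  have Wc : wf c by apply: (wf_children H (i := 0)).
  have Uc : ~~ balanced c.
    by have := node_excess H; rewrite B /=; lia.
  have Ec : nb_leaves c = l by move: E; rewrite /= addn0.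
  have [i Hi Hn] := unbalanced_leaf 1 Wc Uc.
  exists (l + i).-1; first by lia.
  move=> d /(descs_cases H) [->|[[|j] Hj //]]; first by rewrite Edesc eqxx.
  rewrite /offset /= addn0 => Hd _.
  have [V1 V2 V3] := descs_bounds Wc Hd.
  have := Hn d Hd; rewrite /lamn /has_leaf; case: (bal d) => /= [/(_ isT)|_]; lia.
have Wc : wf c by apply: (wf_children H (i := 0)).
have Wc' : wf c' by apply: (wf_children H (i := 1)).
have := wf_nb_leaves_gt0 Wc; have := wf_nb_leaves_gt0 Wc' => P' P.
exists (nb_leaves c); first by move: E => /=; lia.
move=> d Hd0; have [A1 A2 A3] := descs_bounds H Hd0.
case/(descs_cases H): Hd0 => [->|[j Hj Hd] _]; first by rewrite Edesc eqxx.
have [V1 V2 V3] := child_bounds H Hj Hd.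
move: E A3 => /= E A3.
case: j Hj Hd V1 V3 => [|j] Hj Hd V1 V3.
  by move: V1 V3; rewrite /offset /lamn /=; lia.
by move: V1 V3; rewrite /offset /lamn /=; lia.
Qed.

(** * Unions of sets [lambda] *)

Lemma exists_widest (K : seq desc) (p : pred desc) :
  has p K -> exists2 d, d \in K & p d /\ forall d', d' \in K -> p d' -> width d' <= width d.
Proof.
elim: K => //= d K IH; have [/IH [m mK [pm maxm]] _|/hasPn nK] := boolP (has p K).
  have [/andP [pd L]|] := boolP (p d && (width m <= width d)).
    exists d; rewrite ?mem_head //; split=> // d'; rewrite inE => /predU1P [->//|dK] pd'.
    exact: leq_trans (maxm _ dK pd') L.
  move=> H; exists m; first by rewrite inE mK orbT.
  split=> // d'; rewrite inE => /predU1P [->|]; last exact: maxm.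
  by move=> pd; move: H; rewrite pd -ltnNge => /ltnW.
rewrite orbF => pd; exists d; rewrite ?mem_head //; split=> // d'.
by rewrite inE => /predU1P [->//|/nK /negbTE ->].
Qed.

Definition in_range (l : nat) (d : desc) : Prop :=
  [/\ 1 <= first d, 0 < width d & first d + width d <= l.+1].

Lemma desc_eq (d d' : desc) :
  first d = first d' -> width d = width d' -> bal d = bal d' -> d = d'.
Proof. by case: d d' => [[s n] b] [[s' n'] b']; rewrite /first /width /bal /= => -> -> ->. Qed.

(* Take the widest member of [K] that meets [d0] at its first index; if it were
   narrower than [d0], the member of [K] covering the next gap would strictly contain it. *)
Lemma union_lamn_mem l T (K : seq desc) d0 :
  wf T -> nb_leaves T = l -> in_range l d0 -> {subset K <= descs 1 T} ->
  (exists2 x, 0 < x < 2 * l & lamn l d0 x) ->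
  (forall x, 0 < x < 2 * l -> lamn l d0 x = has (fun d => lamn l d x) K) ->
  d0 \in K.
Proof.
move=> H E [r1 r2 r3] KD [x0 x0r Lx0] cover.
have range d : d \in K -> in_range l d.
  by move=> /KD /(descs_bounds H) [A B C]; split=> //; rewrite E in C.
have sub d x : d \in K -> lamn l d x -> lamn l d0 x.
  move=> dK Lx; have [A B C] := range d dK.
  rewrite cover; last by move: Lx; rewrite /lamn; lia.
  by apply/hasP; exists d.
have [b0|b0] := boolP (bal d0); last first.
  have n0 : 1 < width d0 by move: Lx0; rewrite /lamn (negbTE b0); lia.
  (* A balanced member would bring a leaf index into the set of the unbalanced [d0], which has only
     gaps. *)
  have unb d : d \in K -> bal d = false.
    move=> dK; apply/negP => Bd; have [A B C] := range d dK.
    have := sub d (l + first d).-1 dK; rewrite /lamn Bd (negbTE b0) /=; lia.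
  have /exists_widest [d dK [Ld maxd]] : has (fun d => lamn l d (first d0)) K.
    by rewrite -cover /lamn; lia.
  have [A B C] := range d dK; have Ud := unb d dK.
  have n1 : 1 < width d by move: Ld; rewrite /lamn Ud; lia.
  have F : first d = first d0.
    have := sub d (first d) dK; move: Ld; rewrite /lamn Ud (negbTE b0) /=; lia.
  have W : width d <= width d0.
    have := sub d (first d + width d).-2 dK; rewrite /lamn Ud (negbTE b0) /=; lia.
  have [e|ne] := eqVneq (width d) (width d0).
    by rewrite (_ : d0 = d) //; apply: desc_eq; rewrite ?Ud ?(negbTE b0).
  have /hasP [d2 d2K Ld2] : has (fun d' => lamn l d' (first d + width d).-1) K.
    rewrite -cover /lamn; lia.
  have Ud2 := unb d2 d2K; have [A2 B2 C2] := range d2 d2K.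
  have := @descs_laminar 1 T d d2 (first d + width d).-1 H (KD _ dK) (KD _ d2K).
  have := maxd d2 d2K; move: Ld2; rewrite /has_leaf /within /lamn Ud2 /=; lia.
have /exists_widest [d dK [/andP [Bd Ld] maxd]] :
    has (fun d => bal d && has_leaf d (first d0)) K.
  have : has (fun d => lamn l d (l + first d0).-1) K.
    by rewrite -cover /lamn ?b0; lia.
  move=> /hasP [d dK Ld]; apply/hasP; exists d => //; have [A B C] := range d dK.
  by move: Ld; rewrite /lamn /has_leaf; case: (bal d) => /=; lia.
have [A B C] := range d dK.
have leaves i : has_leaf d i -> has_leaf d0 i.
  have := sub d (l + i).-1 dK; rewrite /lamn /has_leaf Bd b0 /=; lia.
have F : first d = first d0.
  by have := leaves (first d); move: Ld; rewrite /has_leaf; lia.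
have W : width d <= width d0.
  by have := leaves (first d + width d).-1; rewrite /has_leaf; lia.
have [e|ne] := eqVneq (width d) (width d0).
  by rewrite (_ : d0 = d) //; apply: desc_eq; rewrite ?Bd ?b0.
(* The index is the gap just after the last leaf of [d], so [d2] has leaves on both sides of it and
   strictly contains [d]. *)
have /hasP [d2 d2K Ld2] : has (fun d' => lamn l d' (first d + width d).-1) K.
  rewrite -cover /lamn; lia.
have [A2 B2 C2] := range d2 d2K.
have In2 : has_leaf d2 (first d + width d).-1 && has_leaf d2 (first d + width d).
  by move: Ld2; rewrite /lamn /has_leaf; case: (bal d2) => /=; lia.
have sub2 : within d d2 /\ width d < width d2.
  have := @descs_laminar 1 T d d2 (first d + width d).-1 H (KD _ dK) (KD _ d2K).
  move: In2; rewrite /has_leaf /within; lia.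
(* By maximality of [d] among the balanced members, [d2] is unbalanced. It then has a leaf [i] that
   only balanced descriptors containing [d2] can cover. *)
have Ud2 : ~~ bal d2.
  apply/negP => Bd2; have := maxd d2 d2K; rewrite Bd2.
  by move: sub2 Ld; rewrite /within /has_leaf; clear; lia.
have [i Li Hi] := unbalanced_desc_leaf H (KD _ d2K) Ud2.
have n2 : 1 < width d2 by clear -sub2 B; lia.
have G1 : lamn l d0 (first d2) by apply: (sub d2) => //; rewrite /lamn; clear -n2; lia.
have G2 : lamn l d0 (first d2 + width d2).-2.
  by apply: (sub d2) => //; rewrite /lamn; clear -n2; lia.
have {}G1 : first d0 <= first d2.
  by move: G1; rewrite /lamn b0; clear -n2 A2 C2 r3 r1; lia.
have {}G2 : first d2 + width d2 <= first d0 + width d0.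
  by move: G2; rewrite /lamn b0; clear -n2 A2 C2 r3 r1; lia.
(* The index of leaf [i] lies in the set of [d0], so a balanced [d3] in [K] covers it. This [d3]
   contains [d2], hence is wider than [d]: a contradiction. *)
have Li0 : lamn l d0 (l + i).-1.
  by move: Li; rewrite /lamn /has_leaf b0; clear -G1 G2 A2; lia.
have : 0 < (l + i).-1 < 2 * l by move: Li; rewrite /has_leaf; clear -A2 C2; lia.
move=> /cover; rewrite Li0 => /esym /hasP [d3 d3K Ld3].
have [A3 B3 C3] := range d3 d3K.
have /andP [Bd3 L3] : bal d3 && has_leaf d3 i.
  move: Ld3 Li; rewrite /lamn /has_leaf; clear -A2 C2 A3 C3.
  by case: (bal d3) => /=; lia.
have W3 := Hi d3 (KD _ d3K) Bd3 L3; have M3 := maxd d3 d3K; rewrite Bd3 in M3.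
by move: sub2 Ld W3 M3; rewrite /within /has_leaf; clear; lia.
Qed.

(** * Pebble cones *)

Section Cones.
Import GRing.Theory Num.Theory Order.TTheory.
Local Open Scope ring_scope.
Variables (R : realType) (n : nat).
Implicit Types (vs ws : seq 'rV[R]_n) (J : {set 'I_n}).

Lemma mem_conic_hull vs v : v \in vs -> conic_hull vs v.
Proof.
move=> H; have Hi : (index v vs < size vs)%N by rewrite index_mem.
exists (fun k => (k == Ordinal Hi)%:R); split; first by move=> k; rewrite ler0n.
rewrite (bigD1 (Ordinal Hi)) //= eqxx scale1r nth_index // big1 ?addr0 // => k /negbTE ->.
by rewrite scale0r.
Qed.

Lemma conic_hull_subset vs ws :
  {subset vs <= ws} -> (conic_hull vs `<=` conic_hull ws)%classic.
Proof.
move=> sub x [a [a0 ->]].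
have idx (k : 'I_(size vs)) : (index (nth 0%R vs k) ws < size ws)%N.
  by rewrite index_mem sub // mem_nth.
(* Equal vectors of [vs] are sent to the same position in [ws], where their coefficients add up. *)
exists (fun m => \sum_(k | Ordinal (idx k) == m) a k); split.
  by move=> m; apply: sumr_ge0.
rewrite (partition_big (fun k => Ordinal (idx k)) predT) //=; apply: eq_bigr => m _.
rewrite scaler_suml; apply: eq_bigr => k /eqP <- /=.
by rewrite nth_index // sub // mem_nth.
Qed.

Lemma ray_coord J j : ray R J 0 j = n%:R * (j \in J)%:R - #|J|%:R.
Proof.
have sum_delta (A : {set 'I_n}) : (\sum_(i in A) delta_mx 0 i : 'rV[R]_n) 0 j = (j \in A)%:R.
  rewrite summxE; have [jA|jA] := boolP (j \in A).
    rewrite (bigD1 j) //= mxE !eqxx big1 ?addr0 // => i /andP [_ /negbTE ne].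
    by rewrite mxE eq_sym ne andbF.
  rewrite big1 // => i iA; rewrite mxE (_ : (j == i) = false) ?andbF //.
  by apply/eqP => ji; rewrite ji iA in jA.
rewrite /ray !mxE !sum_delta inE.
have -> : n%:R = #|J|%:R + #|~: J|%:R :> R by rewrite -natrD cardsC card_ord.
case: (j \in J) => /=; rewrite ?mulr0n ?mulr1n; ring.
Qed.

(* Modulo the all-ones vector, [ray J] is a multiple of the indicator of [J];
   the index [j0] fixes the ambiguity. *)
Lemma ray_conic_hull_union (X : eqType) (L : X -> {set 'I_n}) (D : seq X) J j0 :
  (forall d, d \in D -> L d != [set: 'I_n]%SET -> j0 \notin L d) -> J != [set: 'I_n]%SET ->
  conic_hull [seq ray R (L d) | d <- D] (ray R J) ->
  exists2 K : seq X, {subset K <= D} &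
    forall j, (j \in J) = has (fun d => j \in L d) K.
Proof.
move=> private JT [a [a0 eqJ]].
have n0 : 0 < n%:R :> R by rewrite ltr0n (leq_trans _ (ltn_ord j0)).
move: a a0 eqJ; rewrite size_map => a a0 /rowP eqJ.
pose Dk k := tnth (in_tuple D) k.
have DkD k : Dk k \in D by apply: mem_tnth.
pose S j := \sum_k a k * (j \in L (Dk k))%:R.
(* Comparing coordinates and dividing by [n] leaves an identity between indicators up to a
   constant. *)
have [c eqS] : exists c, forall j, S j = (j \in J)%:R + c.
  exists ((\sum_k a k * #|L (Dk k)|%:R - #|J|%:R) / n%:R) => j.
  have := eqJ j; rewrite summxE ray_coord.
  under eq_bigr => k _ do
    rewrite mxE (nth_map (Dk k)) // -(@tnth_nth _ _ _ (in_tuple D)) ray_coord mulrBr mulrCA.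
  rewrite sumrB -mulr_sumr -/(S j) => e.
  apply: (mulfI (lt0r_neq0 n0)); rewrite mulrDr mulrCA divff ?lt0r_neq0 // mulr1.
  by move: e; rewrite -/(S j); lra.
(* Full sets only contribute a constant. Without them the sum vanishes at [j0], which determines the
   remaining constant. *)
pose proper k := L (Dk k) != [set: 'I_n]%SET.
pose S' j := \sum_(k | proper k) a k * (j \in L (Dk k))%:R.
have eqS' j : S' j = (j \in J)%:R - (j0 \in J)%:R.
  have split i : S i = S' i + \sum_(k | ~~ proper k) a k.
    rewrite /S (bigID proper) /=; congr (_ + _); apply: eq_bigr => k.
    by rewrite /proper negbK => /eqP ->; rewrite inE mulr1.
  have S0 : S' j0 = 0.
    by apply: big1 => k /(private _ (DkD k)) /negbTE ->; rewrite mulr0.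
  have := eqS j; have := eqS j0; rewrite !split S0; lra.
have S'0 j : 0 <= S' j by apply: sumr_ge0 => k _; rewrite mulr_ge0.
(* Otherwise the nonnegative sum [S'] would be [-1] at an index outside [J]. *)
have j0J : j0 \notin J.
  have [j1 _ j1J] : exists2 j1, j1 \in [set: 'I_n]%SET & j1 \notin J.
    by apply/subsetPn; rewrite finset.subTset.
  have := S'0 j1; rewrite eqS' (negbTE j1J); case: (j0 \in J) => //=; lra.
(* Now [S'] is the indicator of [J], so [J] is the union of the proper sets with positive
   coefficient. *)
exists [seq Dk k | k <- enum 'I_(size D) & proper k && (0 < a k)].
  by move=> d /mapP [k _ ->].
move=> j; rewrite has_map; apply/idP/hasP => [jJ|[k]].
  have : S' j != 0 by rewrite eqS' jJ (negbTE j0J) subr0 oner_neq0.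
  rewrite psumr_neq0; last by move=> k _; rewrite mulr_ge0.
  move=> /hasP [k _ /andP [pk]]; case: (boolP (j \in L (Dk k))) => jk; last by rewrite mulr0 ltxx.
  rewrite mulr1 => ak; exists k => //.
  by rewrite mem_filter pk ak mem_enum.
rewrite mem_filter /= => /andP [/andP [pk ak] _] jk.
have : S' j != 0.
  rewrite psumr_neq0; last by move=> i _; rewrite mulr_ge0.
  by apply/hasP; exists k; rewrite ?mem_index_enum // pk jk mulr1.
by rewrite eqS' (negbTE j0J) subr0; case: (j \in J); rewrite ?eqxx.
Qed.
End Cones.

(** * Containment of pebble cones *)

Definition lam (l : nat) (d : desc) : {set 'I_(2 * l).-1} :=
  [set j : 'I_(2 * l).-1 | lamn l d j.+1]%SET.

(** The truncated subtractions in [lambda] are harmless because first leaves and numbers of leaves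
    are positive; the auxiliary invariant on subtrees records this. *)
Lemma pebble_coneE (R : realType) l T : wf T ->
  pebble_cone R l T = conic_hull [seq ray R (lam l d) | d <- descs 1 T].
Proof.
move=> H; rewrite /pebble_cone /descs -map_comp; congr (conic_hull _).
have: all (fun sS => (0 < sS.1) && wf sS.2) (subtrees 1 T).
  suff: forall s, 0 < s -> all (fun sS => (0 < sS.1) && wf sS.2) (subtrees s T).
    by apply.
  elim/ptree_nested_ind: T H => [|k cs IH] H s s0; first by rewrite /= s0.
  rewrite /= -/(wf (PNode k cs)) s0 H /=.
  have: forall i, i < size cs -> forall s, 0 < s ->
      all (fun sS => (0 < sS.1) && wf sS.2) (subtrees s (nth PLeaf cs i)).
    by move=> i Hi s' Hs'; apply: IH i Hi (wf_children H Hi) s' Hs'.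
  elim: cs s s0 {IH H} => //= c cs IHc s s0 IH.
  rewrite all_cat (IH 0) // IHc //; first by lia.
  by move=> i; apply: (IH i.+1).
elim: (subtrees 1 T) => //= -[s S] st IH /andP [/andP [/= s0 WS] /IH ->].
congr (ray R _ :: _); apply/setP => j; rewrite !inE /lamn /descriptor /first /width /bal /=.
have := wf_nb_leaves_gt0 WS; case: (balanced S) => /=; lia.
Qed.

(** The rays of the full and the empty set are zero, so the cones carry no information on these
    descriptors. They are the root and the unbalanced single leaves, which occur in every tree. Any
    other ray yields a union of sets, to which [union_lamn_mem] applies. *)
Lemma subset_descs_cone (R : realType) l T T' :
  0 < l -> pebble_tree l T -> pebble_tree l T' ->
  (pebble_cone R l T `<=` pebble_cone R l T')%classic <->
  {subset descs 1 T <= descs 1 T'}.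
Proof.
move=> l0 /and3P [/eqP E W B] /and3P [/eqP E' W' B']; rewrite all_subtrees_wf in W.
rewrite all_subtrees_wf in W'; rewrite !pebble_coneE //; split; last first.
  by move=> sub; apply: conic_hull_subset => v /mapP [d /sub dT ->]; apply: map_f.
move=> sub d dT; have [A1 A2 A3] := descs_bounds W dT; rewrite E in A3.
have ord x : 0 < x < 2 * l -> x.-1 < (2 * l).-1 by lia.
have in_lam d' x (xr : 0 < x < 2 * l) : (Ordinal (ord x xr) \in lam l d') = lamn l d' x.
  by rewrite inE /= prednK ?(andP xr).1.
have [/eqP fullJ|JT] := boolP (lam l d == [set: 'I_(2 * l).-1]%SET).
  suff -> : d = (1, nb_leaves T', balanced T') by apply: mem_descs_root.
  have full x : 0 < x < 2 * l -> lamn l d x by move=> xr; rewrite -(in_lam _ _ xr) fullJ inE.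
  (* The indices of the last and the first leaf: covering both forces [d] to be balanced and of full
     width. *)
  have lastJ : lamn l d (l + l).-1 by apply: full; lia.
  have firstJ : lamn l d l by apply: full; lia.
  rewrite E' B'; apply: desc_eq; move: lastJ firstJ;
    rewrite /lamn /bal /first /width /= -/(first d) -/(width d) -/(bal d);
    case: (bal d) => //=; lia.
have [J0|[j jJ]] := set_0Vmem (lam l d).
  suff -> : d = (first d, 1, false) by apply: mem_descs_leaf => //; rewrite E'; lia.
  have empty x : 0 < x < 2 * l -> ~~ lamn l d x.
    by move=> xr; rewrite -(in_lam _ _ xr) J0 inE.
  have Bd : bal d = false.
    apply/negbTE/negP => Bd; have := empty (l + first d).-1.
    by rewrite /lamn Bd; lia.
  apply: desc_eq => //; have := empty (first d); rewrite /lamn Bd /width /=.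
  rewrite -/(width d); lia.
have rootlam d' : d' \in descs 1 T' -> lam l d' != [set: 'I_(2 * l).-1]%SET -> d' != (1, l, true).
  move=> _; apply: contraNneq => ->; apply/eqP/setP => i; rewrite !inE /lamn /first /width /=.
  by have := ltn_ord i; lia.
have [x xr xP] := root_private_index W' B' E'.
have [K KD KJ] : exists2 K : seq desc, {subset K <= descs 1 T'} &
    forall j, (j \in lam l d) = has (fun d' => j \in lam l d') K.
  apply: (@ray_conic_hull_union R _ _ _ _ _ (Ordinal (ord x xr))) => //.
    move=> d' d'T' /(rootlam _ d'T') /(xP _ d'T').
    by rewrite in_lam.
  by apply: sub; apply: mem_conic_hull; apply: (map_f (fun d => ray R (lam l d))).
apply: (KD); apply: (union_lamn_mem W' E' _ KD); first by split=> //; lia.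
  by exists j.+1; [have := ltn_ord j; lia | move: jJ; rewrite inE].
move=> y yr; have := KJ (Ordinal (ord y yr)); rewrite in_lam => ->.
by apply: eq_has => d'; rewrite in_lam.
Qed.

(** * Contraction of oriented trees *)

Definition is_to (h : heading) : bool := if h is ToRoot then true else false.

Definition nb_arrows (t : otree) : nat := size (leaf_arrows t).

Definition forest_arrows (cs : seq otree) : seq heading := flatten (map leaf_arrows cs).

(* An external incoming arrow counts as a balanced node above an unbalanced leaf,
   in accordance with [pebbled] below. *)
Fixpoint odescs (s : nat) (t : otree) : seq desc :=
  match t with
  | Arrow ToRoot => [:: (s, 1, true); (s, 1, false)]
  | Arrow FromRoot => [:: (s, 1, false)]
  | Node h cs => (s, nb_arrows t, is_to h) ::
      (fix forest (s : nat) (cs : seq otree) : seq desc :=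
         match cs with
         | [::] => [::]
         | c :: cs' => odescs s c ++ forest (s + nb_arrows c) cs'
         end) s cs
  end.

Fixpoint forest_odescs (s : nat) (cs : seq otree) : seq desc :=
  if cs is c :: cs' then odescs s c ++ forest_odescs (s + nb_arrows c) cs' else [::].

Lemma odescs_node s h cs :
  odescs s (Node h cs) = (s, size (forest_arrows cs), is_to h) :: forest_odescs s cs.
Proof. by rewrite /=; congr cons; elim: cs s => //= c cs IH s; rewrite IH. Qed.

Lemma forest_odescs_cons s c cs :
  forest_odescs s (c :: cs) = odescs s c ++ forest_odescs (s + nb_arrows c) cs.
Proof. by []. Qed.

Lemma odescs_arrow s h : odescs s (Arrow h) =
  (s, 1, is_to h) :: (if is_to h then [:: (s, 1, false)] else [::]).
Proof. by case: h. Qed.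

Lemma forest_arrows_cat cs cs' :
  forest_arrows (cs ++ cs') = forest_arrows cs ++ forest_arrows cs'.
Proof. by rewrite /forest_arrows map_cat flatten_cat. Qed.

Lemma forest_odescs_cat s cs cs' :
  forest_odescs s (cs ++ cs') =
  forest_odescs s cs ++ forest_odescs (s + size (forest_arrows cs)) cs'.
Proof.
elim: cs s => [|c cs IH] s /=; first by rewrite addn0.
by rewrite IH catA /forest_arrows /= size_cat addnA.
Qed.

Lemma mem_odescs_root s t : (s, nb_arrows t, is_to (top_arrow t)) \in odescs s t.
Proof. by case: t => [[]|h cs]; rewrite inE eqxx. Qed.

Lemma otree_forest_ind (Q : otree -> Prop) (Qs : seq otree -> Prop) :
  (forall h, Q (Arrow h)) -> (forall h cs, Qs cs -> Q (Node h cs)) ->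
  Qs [::] -> (forall c cs, Q c -> Qs cs -> Qs (c :: cs)) ->
  (forall t, Q t) * (forall cs, Qs cs).
Proof.
move=> QA QN Q0 QC.
have QT : forall t, Q t.
  fix IH 1 => -[h|h cs]; first exact: QA.
  by apply: QN; elim: cs => [|c cs IHcs]; [exact: Q0 | apply: QC; [exact: IH|]].
by split=> //; elim=> // c cs; apply: QC.
Qed.

(** These arrows are outgoing at the parent node; they correspond to its unbalanced children in the
    pebble tree. *)
Definition from_count (cs : seq otree) : nat :=
  count (fun c => ~~ is_to (top_arrow c)) cs.

(** Incoming and outgoing arrows together number [(size cs).+1], so only the outgoing ones need
    counting. *)
Lemma admissible_incident h cs :
  admissible_node (incident_arrows h cs) =
  [&& 0 < size cs, 0 < is_to h + from_count cs &
      ~~ ((size cs == 1) && (is_to h + from_count cs == 1))].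
Proof.
have outs : count is_out (incident_arrows h cs) = is_to h + from_count cs.
  rewrite /= count_map; congr (_ + _); first by case: h.
  by apply: eq_count => c /=; case: (top_arrow c).
have ins : count is_inc (incident_arrows h cs) + count is_out (incident_arrows h cs) =
    (size cs).+1.
  rewrite outs /= count_map.
  have -> : count (preim (fun c => from_upper_end (top_arrow c)) is_inc) cs =
      count (fun c => is_to (top_arrow c)) cs.
    by apply: eq_count => c /=; case: (top_arrow c).
  rewrite -(count_predC (fun c => is_to (top_arrow c)) cs).
  have -> : count (predC (fun c => is_to (top_arrow c))) cs = from_count cs by [].
  by case: h {outs} => /=; lia.
move: ins; rewrite /admissible_node outs /= size_map; lia.
Qed.

Lemma admissible_node_inv h cs : admissible_nodes (Node h cs) ->
  admissible_node (incident_arrows h cs) /\ all admissible_nodes cs.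
Proof. by move=> /andP. Qed.

Lemma admissible_nonempty :
  (forall t, admissible_nodes t -> 0 < nb_arrows t) *
  (forall cs, all admissible_nodes cs -> size cs <= size (forest_arrows cs)).
Proof.
apply: otree_forest_ind => //= [h cs IH /andP [H /IH {}IH]|c cs IHc IHs /andP [/IHc Hc /IHs]].
  by move: H; rewrite admissible_incident => /andP [H _]; apply: leq_trans IH.
by move: Hc; rewrite /nb_arrows /forest_arrows /= size_cat; lia.
Qed.

Lemma nb_arrows_gt0 t : admissible_nodes t -> 0 < nb_arrows t.
Proof. exact: admissible_nonempty.1. Qed.

Lemma size_forest_arrows cs :
  all admissible_nodes cs -> size cs <= size (forest_arrows cs).
Proof. exact: admissible_nonempty.2. Qed.

Lemma odescs_forest_bounds :
  (forall t, forall s d, admissible_nodes t -> d \in odescs s t ->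
    [/\ s <= first d, 0 < width d & first d + width d <= s + nb_arrows t]) *
  (forall cs, forall s d, all admissible_nodes cs -> d \in forest_odescs s cs ->
    [/\ s <= first d, 0 < width d & first d + width d <= s + size (forest_arrows cs)]).
Proof.
apply: otree_forest_ind => [h|h cs IH|//|c cs IHc IHs] s d H.
- by rewrite odescs_arrow !inE => /predU1P [->|];
    last by case: (is_to h) => //; rewrite inE => /eqP ->.
- have H1 := nb_arrows_gt0 H; case/admissible_node_inv: H => _ H.
  rewrite odescs_node inE => /predU1P [->|/(IH _ _ H)] //.
- case/andP: H => Hc Hs; rewrite mem_cat /forest_arrows /= size_cat => /orP [].
    by case/(IHc _ _ Hc) => A B C; split=> //; move: C; rewrite /nb_arrows; lia.
  by case/(IHs _ _ Hs); rewrite /nb_arrows => A B C; split=> //;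
    move: A C; rewrite /forest_arrows; lia.
Qed.

Lemma odescs_bounds t s d : admissible_nodes t -> d \in odescs s t ->
  [/\ s <= first d, 0 < width d & first d + width d <= s + nb_arrows t].
Proof. exact: odescs_forest_bounds.1. Qed.

Lemma forest_odescs_bounds cs s d : all admissible_nodes cs -> d \in forest_odescs s cs ->
  [/\ s <= first d, 0 < width d & first d + width d <= s + size (forest_arrows cs)].
Proof. exact: odescs_forest_bounds.2. Qed.

(** A node with two incident arrows, at least one outgoing but not one of each kind, has both
    outgoing. *)
Lemma admissible_single h c : admissible_nodes (Node h [:: c]) ->
  h = ToRoot /\ top_arrow c = FromRoot.
Proof.
by move=> /admissible_node_inv [+ _]; rewrite admissible_incident /from_count /=;
  case: h; case: (top_arrow c).
Qed.

Lemma full_width_single h cs s b : admissible_nodes (Node h cs) ->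
  (s, size (forest_arrows cs), b) \in forest_odescs s cs -> exists c, cs = [:: c].
Proof.
move=> /admissible_node_inv [_]; case: cs => [|c [|c2 r]] //; first by exists c.
move=> /= /and3P [Hc Hc2 Hr]; rewrite mem_cat => /orP [].
  case/(odescs_bounds Hc) => _ _; have := nb_arrows_gt0 Hc2.
  rewrite /first /width /forest_arrows /= !size_cat /nb_arrows; lia.
have Hcs : all admissible_nodes (c2 :: r) by rewrite /= Hc2.
case/(forest_odescs_bounds Hcs); have := nb_arrows_gt0 Hc.
by rewrite /first /width /=; lia.
Qed.

(** Full width forces a single child, and by [admissible_single] the child heads away from the root.
    It therefore cannot have a single child in turn, so it alone has full width below the node. *)
Lemma admissible_full_width h cs s b : admissible_nodes (Node h cs) ->
  (s, size (forest_arrows cs), b) \in forest_odescs s cs -> h = ToRoot /\ b = false.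
Proof.
move=> H full; have [c Ec] := full_width_single H full; subst cs.
have [-> topc] := admissible_single H; split=> //.
move: full; rewrite /forest_arrows /= !cats0.
case: c topc H => [g|g ds] /= -> H; first by rewrite inE => /eqP [].
rewrite -/(odescs s (Node FromRoot ds)) odescs_node inE => /predU1P [[]//|full].
have Hd : admissible_nodes (Node FromRoot ds) by move: H => /= /andP [_ /andP []].
have [c Ec] := full_width_single Hd full; subst ds.
by have [] := admissible_single Hd.
Qed.

(** Internal nodes over one external arrow would have single children. At most one such node fits,
    and its two arrows have opposite headings. *)
Lemma one_arrow_tree t h : admissible_nodes t -> leaf_arrows t = [:: h] ->
  top_arrow t = h -> t = Arrow h.
Proof.
case: t => [g|g cs] H //=; first by move=> _ ->.
have [_ Hcs] := admissible_node_inv H.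
have := size_forest_arrows Hcs; rewrite /forest_arrows => + L; rewrite L.
case: cs => [|c [|//]] in H Hcs L *; first by case/andP: H.
move=> _; have [-> topc] := admissible_single H => Eh; subst h.
move: L; rewrite /= cats0; case: c topc Hcs {H} => [g'|g' ds] /= ->; first by [].
rewrite andbT => Hd L; have [_ Hds] := admissible_node_inv Hd.
have := size_forest_arrows Hds; rewrite /forest_arrows L.
case: ds => [|c [|//]] in Hd {Hds L} *; first by case/andP: Hd.
by have [] := admissible_single Hd.
Qed.

(** * Contraction as containment of descriptors *)

Notation contracts := (clos_refl_trans otree contract1).

Lemma contracts_below h l c c' r : contracts c c' ->
  contracts (Node h (l ++ c :: r)) (Node h (l ++ c' :: r)).
Proof.
elim=> [x y xy|x|x y z _ IH1 _ IH2].
- by apply: rt_step; apply: contract_below.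
- exact: rt_refl.
- exact: rt_trans IH1 IH2.
Qed.

(** The arrows on top of a forest can only be contracted into a node above it, so the forest is
    placed under an arbitrary node, after arbitrary siblings. *)
Definition forest_contracts (cs cs' : seq otree) : Prop :=
  forall h l, contracts (Node h (l ++ cs)) (Node h (l ++ cs')).

Lemma forest_contracts_cons c c' cs cs' :
  contracts c c' -> forest_contracts cs cs' -> forest_contracts (c :: cs) (c' :: cs').
Proof.
move=> Hc Hcs h l; apply: rt_trans (contracts_below h l cs Hc) _.
by rewrite -!cat_rcons; apply: Hcs.
Qed.

Lemma forest_contracts_node g ds cs cs' :
  forest_contracts (ds ++ cs) cs' -> forest_contracts (Node g ds :: cs) cs'.
Proof.
move=> H h l; apply: rt_trans (H h l).
by apply: rt_step; apply: contract_here.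
Qed.

(** External arrows count as well, so that this induction measure also drops when a forest loses its
    first tree. *)
Fixpoint nb_nodes (t : otree) : nat :=
  if t is Node _ cs then (sumn (map nb_nodes cs)).+1 else 1.

Definition forest_nodes (cs : seq otree) : nat := sumn (map nb_nodes cs).

Lemma nb_nodes_gt0 t : 0 < nb_nodes t. Proof. by case: t. Qed.

Lemma is_to_inj h h' : is_to h = is_to h' -> h = h'.
Proof. by case: h; case: h'. Qed.

Definition forest_reflects (n : nat) : Prop := forall fs' fs s,
  forest_nodes fs' < n -> all admissible_nodes fs' -> all admissible_nodes fs ->
  forest_arrows fs = forest_arrows fs' ->
  {subset forest_odescs s fs <= forest_odescs s fs'} -> forest_contracts fs' fs.

Lemma tree_reflects n t t' s : forest_reflects n -> nb_nodes t' <= n ->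
  admissible_nodes t -> admissible_nodes t' -> top_arrow t = top_arrow t' ->
  leaf_arrows t = leaf_arrows t' -> {subset odescs s t <= odescs s t'} ->
  contracts t' t.
Proof.
move=> refl Hn H H' et el sub.
case: t' => [g|g ds] in Hn H' et el sub *.
  by rewrite (one_arrow_tree H el et); apply: rt_refl.
case: t => [h|h es] in H et el sub *.
  by rewrite (one_arrow_tree H' (esym el) (esym et)); apply: rt_refl.
move: et el => /= et el; subst g.
have [_ Hes] := admissible_node_inv H; have [_ Hds] := admissible_node_inv H'.
apply: (refl ds es s _ Hds Hes el _ h [::]) => //.
move=> d des; have := sub d; rewrite !odescs_node !inE des orbT => /(_ isT).
(* The root descriptor cannot recur below the root: by [admissible_full_width], [h] would head to
   the root while its own balance bit is false. *)
case/predU1P => [Ed|//]; move: des; rewrite Ed -[forest_arrows ds]el.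
by case/(admissible_full_width H) => ->.
Qed.

(* Compare the first trees of the two forests: either they have the same descriptor and one
   proceeds componentwise, or the first tree of the finer forest is a node without
   counterpart in the coarser one, and the arrow above it is contracted. *)
Lemma odescs_subset_forest_contracts n : forest_reflects n.
Proof.
elim: n => // n IH [|c' r'] fs s Hn Hfs' Hfs arr sub.
  have := size_forest_arrows Hfs; rewrite arr; case: fs {Hfs arr sub} => // _ h l.
  exact: rt_refl.
case: fs => [|c r] in Hfs arr sub *.
  by have := size_forest_arrows Hfs'; rewrite -arr.
have /andP [Hc Hr] := Hfs; have /andP [Hc' Hr'] := Hfs'.
have nc := nb_arrows_gt0 Hc; have nc' := nb_arrows_gt0 Hc'.
have in_first d : d \in forest_odescs s (c' :: r') -> first d < s + nb_arrows c' ->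
    d \in odescs s c'.
  by rewrite mem_cat => /orP [//|/(forest_odescs_bounds Hr') []]; lia.
have rootc : (s, nb_arrows c, is_to (top_arrow c)) \in odescs s c'.
  apply: in_first; last by rewrite /first /=; lia.
  by apply: sub; rewrite mem_cat mem_odescs_root.
have [[eqn eqt]|neq] : nb_arrows c = nb_arrows c' /\ top_arrow c = top_arrow c' \/
    (nb_arrows c, is_to (top_arrow c)) != (nb_arrows c', is_to (top_arrow c')).
  have [[e1 e2]|] := eqVneq (nb_arrows c, is_to (top_arrow c))
    (nb_arrows c', is_to (top_arrow c')); last by right.
  by left; split=> //; apply: is_to_inj.
- have eqc : leaf_arrows c = leaf_arrows c'.
    have := congr1 (take (nb_arrows c)) arr; rewrite {2}eqn.
    by rewrite /forest_arrows /= /nb_arrows !take_size_cat.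
  have eqr : forest_arrows r = forest_arrows r'.
    have := congr1 (drop (nb_arrows c)) arr; rewrite {2}eqn.
    by rewrite /forest_arrows /= /nb_arrows !drop_size_cat.
  have subc : {subset odescs s c <= odescs s c'}.
    move=> d dc; have [A B C] := odescs_bounds Hc dc.
    by apply: in_first; [apply: sub; rewrite mem_cat dc | lia].
  have subr : {subset forest_odescs (s + nb_arrows c) r <= forest_odescs (s + nb_arrows c') r'}.
    move=> d dr; have [A B C] := forest_odescs_bounds Hr dr.
    have := sub d; rewrite /= !mem_cat dr orbT => /(_ isT) /orP [|//].
    by case/(odescs_bounds Hc'); clear -A nc eqn; lia.
  apply: forest_contracts_cons; last first.
    rewrite -eqn in subr; apply: (IH _ _ _ _ Hr' Hr eqr subr).
    by move: Hn; rewrite /forest_nodes /=; have := nb_nodes_gt0 c'; lia.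
  apply: (tree_reflects IH) Hc Hc' eqt eqc subc.
  by move: Hn; rewrite /forest_nodes /=; lia.
(* If [c'] is an external arrow, [c] can only match the unbalanced leaf of an incoming one. It would
   then head away from the root over a single incoming arrow, against admissibility. *)
case: c' => [g|g ds] in Hn Hfs' arr sub Hc' nc' in_first rootc neq *.
  move: rootc; rewrite odescs_arrow inE => /predU1P [[e1 e2]|].
    by rewrite e1 e2 eqxx in neq.
  case: g => // in arr {Hn Hfs' sub Hc' neq in_first nc'} *; rewrite inE => /eqP [e1 e2].
  have eqc : leaf_arrows c = [:: ToRoot].
    have := congr1 (take (nb_arrows c)) arr; rewrite {2}e1.
    by rewrite /forest_arrows /= /nb_arrows take_size_cat // take0.
  case: c => [h|h es] in Hc nc e2 eqc {Hfs arr e1} *.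
    by case: eqc e2 => ->.
  have [_ Hes] := admissible_node_inv Hc; have := size_forest_arrows Hes.
  rewrite -[forest_arrows es]/(leaf_arrows (Node h es)) eqc.
  case: es => [|c [|//]] in Hc e2 {nc eqc Hes} *; first by case/andP: Hc.
  by have [Eh _] := admissible_single Hc; rewrite Eh in e2.
apply: forest_contracts_node.
have [_ Hds] := admissible_node_inv Hc'.
apply: (IH _ _ s) => //.
- by move: Hn; rewrite /forest_nodes /= map_cat sumn_cat; clear; lia.
- by rewrite all_cat Hds.
- by rewrite forest_arrows_cat arr.
move=> d dfs; rewrite forest_odescs_cat.
have := sub d dfs; rewrite forest_odescs_cons odescs_node mem_cat inE -orbA.
move=> /or3P [/eqP Ed|dd|dd]; rewrite mem_cat ?dd ?orbT //.
(* If the root descriptor of [c'] occurred in the coarser forest, the distinct root descriptors of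
   [c] and [c'] would each occur in the other tree with equal widths. Applying
   [admissible_full_width] on both sides gives the root of [c] contradictory headings. *)
exfalso; move: neq rootc dfs; rewrite Ed forest_odescs_cons.
rewrite mem_cat odescs_node inE => neq rootc dfs.
have {dfs} dc : (s, size (forest_arrows ds), is_to g) \in odescs s c.
  by case/orP: dfs => // /(forest_odescs_bounds Hr) []; rewrite /first /=; clear -nc; lia.
have [_ _ le1] := odescs_bounds Hc dc.
case/predU1P: rootc => [[e1 e2]|rootc].
  by move: neq; rewrite e2 e1 /nb_arrows /= eqxx.
have [_ _ le2] := forest_odescs_bounds Hds rootc.
have en : nb_arrows c = size (forest_arrows ds).
  by move: le1 le2; rewrite /first /width /=; clear; lia.
rewrite en in rootc; have [Eg Ec] := admissible_full_width Hc' rootc.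
case: c => [h|h es] in Hc en Ec dc {neq rootc le1 le2 nc Hfs arr sub} *.
  by move: dc Ec; rewrite odescs_arrow Eg /=; case: (is_to h) => //; rewrite inE xpair_eqE andbF.
move: dc; rewrite odescs_node -en Eg /= inE => /predU1P [[e]|].
  by move: Ec => /=; rewrite -e.
by case/(admissible_full_width Hc) => Eh _; move: Ec; rewrite Eh.
Qed.

Lemma contract1_odescs t t' : contract1 t t' ->
  [/\ top_arrow t' = top_arrow t, leaf_arrows t' = leaf_arrows t, nb_nodes t' < nb_nodes t &
      forall s, {subset odescs s t' <= odescs s t}].
Proof.
elim=> [h l h' cs r|h l c c' r _ [E1 E2 E3 E4]].
  have arr : forest_arrows (l ++ cs ++ r) = forest_arrows (l ++ Node h' cs :: r).
    by rewrite !forest_arrows_cat.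
  split=> //; first by rewrite /= !map_cat !sumn_cat /= ; lia.
  move=> s d; rewrite !odescs_node arr !inE !forest_odescs_cat forest_odescs_cons odescs_node.
  rewrite /nb_arrows /= !mem_cat inE mem_cat.
  by move=> /orP [->//|/or3P []]; rewrite /forest_arrows => ->; rewrite ?orbT.
have arr : forest_arrows (l ++ c' :: r) = forest_arrows (l ++ c :: r).
  by rewrite !forest_arrows_cat /forest_arrows /= E2.
split=> //; first by rewrite /= !map_cat !sumn_cat /= ; lia.
move=> s d; rewrite !odescs_node arr !inE !forest_odescs_cat /=.
rewrite !mem_cat /nb_arrows E2 => /orP [->//|/or3P [->|/E4 ->|->]]; by rewrite ?orbT.
Qed.

(** The strict drop of [nb_nodes] is what makes contraction antisymmetric. *)
Lemma contracts_odescs t t' : contracts t t' ->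
  [/\ top_arrow t' = top_arrow t, leaf_arrows t' = leaf_arrows t,
      t' = t \/ nb_nodes t' < nb_nodes t &
      forall s, {subset odescs s t' <= odescs s t}].
Proof.
elim=> [x y /contract1_odescs [A B C D]|x|x y z _ [A B C D] _ [A' B' C' D']].
- by split=> //; right.
- by split; [| |left|move=> s d].
- split; rewrite ?A' ?B' //; last by move=> s d /D' /D.
  case: C C' => [->|C] [->|C']; [by left | by right | by right | right; exact: ltn_trans C].
Qed.

Lemma odescs_subset_contracts t t' s :
  admissible_nodes t -> admissible_nodes t' -> top_arrow t = top_arrow t' ->
  leaf_arrows t = leaf_arrows t' ->
  {subset odescs s t <= odescs s t'} -> contracts t' t.
Proof.
exact: tree_reflects (@odescs_subset_forest_contracts _) (leqnn _).
Qed.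

Lemma odescs_antisym t t' s :
  admissible_nodes t -> admissible_nodes t' -> top_arrow t = top_arrow t' ->
  leaf_arrows t = leaf_arrows t' ->
  {subset odescs s t <= odescs s t'} -> {subset odescs s t' <= odescs s t} -> t = t'.
Proof.
move=> H H' et el st st'.
have /contracts_odescs [_ _ [//|L] _] := odescs_subset_contracts H H' et el st.
have /contracts_odescs [_ _ [//|L'] _] :=
  odescs_subset_contracts H' H (esym et) (esym el) st'.
by have := ltn_trans L L'; rewrite ltnn.
Qed.

(** Contracting the arrow above each internal node leaves only external arrows. The siblings [l] and
    [r] stay arbitrary because a contraction merges children into their list. *)
Lemma contracts_corolla :
  (forall t, forall l r, forest_contracts (l ++ t :: r)
      (l ++ map Arrow (leaf_arrows t) ++ r)) *
  (forall cs, forall l r, forest_contracts (l ++ cs ++ r)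
      (l ++ map Arrow (forest_arrows cs) ++ r)).
Proof.
apply: otree_forest_ind => [h l r|h cs IH l r|l r|c cs IHc IHcs l r].
- by move=> ? ?; apply: rt_refl.
- move=> g k; apply: rt_trans (IH l r g k); apply: rt_step.
  by rewrite !(catA k l); apply: contract_here.
- by move=> ? ?; apply: rt_refl.
move=> g k; apply: rt_trans (IHc l (cs ++ r) g k) _.
rewrite /forest_arrows /= map_cat -catA.
have := IHcs (l ++ map Arrow (leaf_arrows c)) r g k.
by rewrite -!catA.
Qed.

(** * The pebble tree of an oriented tree *)

Fixpoint pebbled (t : otree) : ptree :=
  match t with
  | Arrow FromRoot => PLeaf
  | Arrow ToRoot => PNode 1 [:: PLeaf]
  | Node h cs => PNode (from_count cs - ~~ is_to h) (map pebbled cs)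
  end.

Lemma nb_leaves_pebbled t : nb_leaves (pebbled t) = nb_arrows t.
Proof.
suff [H _] : (forall t, nb_leaves (pebbled t) = nb_arrows t) *
  (forall cs, sumn (map nb_leaves (map pebbled cs)) = size (forest_arrows cs)) by exact: H.
apply: otree_forest_ind => [[]|h cs IH||c cs IHc IHcs] //=.
by rewrite IHc IHcs /forest_arrows /= size_cat.
Qed.

(** The pebble numbers are those dictated by [node_excess]. An outgoing arrow at each node makes the
    subtraction in [pebbled] exact, and excluding one incoming with one outgoing arrow puts a pebble
    on each node with a single child. *)
Lemma pebbled_wf t : admissible_nodes t ->
  wf (pebbled t) /\ balanced (pebbled t) = is_to (top_arrow t).
Proof.
suff [H _] : (forall t, admissible_nodes t ->
    wf (pebbled t) /\ nb_leaves (pebbled t) = nb_pebbles (pebbled t) + ~~ is_to (top_arrow t)) *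
  (forall cs, all admissible_nodes cs -> all wf (map pebbled cs) /\
    sumn (map nb_leaves (map pebbled cs)) =
    sumn (map nb_pebbles (map pebbled cs)) + from_count cs).
  by move=> /H [W E]; split=> //; rewrite /balanced E; case: (is_to _); lia.
apply: otree_forest_ind => [[]|h cs IH|//|c cs IHc IHcs] //.
- move=> /admissible_node_inv [+ /IH [W E]]; rewrite admissible_incident => /and3P [A B C].
  have Ex : nb_leaves (pebbled (Node h cs)) =
      nb_pebbles (pebbled (Node h cs)) + ~~ is_to h.
    by rewrite /= E; move: B; case: (is_to h) => /=; lia.
  split=> //; rewrite [wf _]/= -/pebbled W andbT; apply/andP; split.
    rewrite size_map A /=; apply/implyP => s1.
    by move: B C; rewrite s1 /=; case: (is_to h) => /=; lia.
  rewrite -[PNode _ _]/(pebbled (Node h cs)) /balanced /unbalanced Ex.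
  by case: (is_to h); rewrite ?addn0 ?addn1 eqxx ?orbT.
- move=> /= /andP [/IHc [W E] /IHcs [Ws Es]]; split; first by rewrite W.
  by rewrite /from_count /= E Es /from_count; lia.
Qed.

Lemma descs_pebbled s t : admissible_nodes t -> descs s (pebbled t) = odescs s t.
Proof.
suff [H _] : (forall t, forall s, admissible_nodes t -> descs s (pebbled t) = odescs s t) *
  (forall cs, forall s, all admissible_nodes cs ->
     forest_descs s (map pebbled cs) = forest_odescs s cs) by exact: H.
apply: otree_forest_ind => [[]|h cs IH|//|c cs IHc IHcs] {}s //.
- move=> H; have [_ B] := pebbled_wf H; have L := nb_leaves_pebbled (Node h cs).
  rewrite odescs_node [pebbled _]/= descs_node; congr ((_, _, _) :: _); try exact: L.
    exact: B.
  by apply: IH; case/admissible_node_inv: H.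
- by case/andP => Hc Hcs; rewrite /= IHc // nb_leaves_pebbled IHcs.
Qed.

(** * Alpha-trees as pebble trees *)

(** A node over one leaf has a single child, hence a pebble, hence is balanced with exactly one
    pebble. Its child has none left, so it is unbalanced and must be a leaf. *)
Lemma wf_one_leaf T : wf T -> nb_leaves T = 1 ->
  T = if balanced T then PNode 1 [:: PLeaf] else PLeaf.
Proof.
have single k cs : wf (PNode k cs) -> nb_leaves (PNode k cs) = 1 ->
    0 < k /\ exists c, [/\ cs = [:: c], wf c & nb_leaves c = 1].
  case: cs => [|c [|c' cs]] H; first by case/and3P: H.
    rewrite /= addn0 => E; split; first by case/and3P: H.
    by exists c; split=> //; apply: (wf_children H (i := 0)).
  have := wf_nb_leaves_gt0 (wf_children H (i := 0) isT).
  have := wf_nb_leaves_gt0 (wf_children H (i := 1) isT).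
  by rewrite /=; lia.
have unb T' : wf T' -> nb_leaves T' = 1 -> ~~ balanced T' -> T' = PLeaf.
  case: T' => // k cs H E U; have [k0 _] := single _ _ H E.
  by have := wf_excess H; rewrite U E /=; lia.
case: T => // k cs H E; have [k0 [c [Ec Wc Lc]]] := single _ _ H E.
have [B|U] := boolP (balanced _); last by rewrite [PNode _ _]unb.
have := wf_excess H; rewrite B E {1}Ec /= => e.
have Uc : ~~ balanced c by rewrite /balanced Lc; lia.
by rewrite Ec (unb _ Wc Lc Uc); congr (PNode _ _); lia.
Qed.

Lemma forest_descs_bounds s cs d : all wf cs -> d \in forest_descs s cs -> s <= first d.
Proof.
move=> /(all_nthP PLeaf) W /forest_descsP [i Hi Hd].
by have [] := descs_bounds (W i Hi) Hd; lia.
Qed.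

Definition realizes (t : otree) (T : ptree) (hs : seq heading) : Prop :=
  [/\ admissible_nodes t, leaf_arrows t = hs, pebbled t = T &
      is_to (top_arrow t) = balanced T].

(** Where [hs] heads to the root, the balanced one-leaf node is read as an external incoming arrow;
    elsewhere such a node is read as one with two outgoing arrows. The default [FromRoot] makes the
    condition vacuous past the end of [hs]. *)
Lemma exists_pebbled T s hs : wf T -> size hs = nb_leaves T ->
  (forall i, is_to (nth FromRoot hs i) -> (s + i, 1, true) \in descs s T) ->
  exists t, realizes t T hs.
Proof.
elim/ptree_nested_ind: T s hs => [|k cs IH] s hs W.
  case: hs => [|h [|//]] // _ /(_ 0); case: h => /= [/(_ isT)|_].
    by rewrite addn0 inE xpair_eqE andbF.
  by exists (Arrow FromRoot).
move=> Hsz Hin; have Wcs : all wf cs by case/and3P: W.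
(* Either [T] itself is to be read as an incoming arrow, or all required descriptors lie below its
   root and are distributed among the children. *)
have [Ehs|Nhs] : hs = [:: ToRoot] \/ forall i, is_to (nth FromRoot hs i) ->
    (s + i, 1, true) \in forest_descs s cs.
  have [[E1 E2]|N1] : (size hs = 1 /\ is_to (nth FromRoot hs 0)) \/
      ~~ ((size hs == 1) && is_to (nth FromRoot hs 0)).
  - by case: (boolP (_ && _)) => [/andP [/eqP]|]; [left|right].
  - by left; case: hs E1 E2 {Hsz Hin} => [|[] [|]].
  right=> i Hi; have := Hin i Hi; rewrite descs_node inE => /predU1P [[e1 e2 _]|//].
  have i0 : i = 0 by lia.
  by move: N1; rewrite Hsz /= -e2 eqxx -i0 Hi.
- move: Hsz; rewrite Ehs => /esym L; have Bin := Hin 0.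
  rewrite Ehs addn0 in Bin; have {Bin} := Bin isT.
  rewrite (wf_one_leaf W L); case: ifP => B; last by rewrite inE xpair_eqE andbF.
  by exists (Arrow ToRoot).
have [ts [Ats Fts Pts Cts]] : exists ts, [/\ all admissible_nodes ts,
    forest_arrows ts = hs, map pebbled ts = cs &
    from_count ts = count (predC balanced) cs].
  have {}IH : forall i, i < size cs -> forall s hs, size hs = nb_leaves (nth PLeaf cs i) ->
      (forall j, is_to (nth FromRoot hs j) ->
         (s + j, 1, true) \in descs s (nth PLeaf cs i)) ->
      exists t, realizes t (nth PLeaf cs i) hs.
    by move=> i Hi s' hs'; apply: (IH i Hi s' hs' (wf_children W Hi)).
  move: Hsz => /=; elim: cs s hs {Hin W} IH Wcs Nhs => [|c cs IHc] s hs IH.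
    by case: hs => // _ _ _; exists [::].
  move=> /= /andP [Wc Wcs] Nhs Hsz.
  have Htake : size (take (nb_leaves c) hs) = nb_leaves c.
    by rewrite size_take Hsz; case: ltnP => //; lia.
  have [t [A1 A2 A3 A4]] : exists t, realizes t c (take (nb_leaves c) hs).
    apply: (IH 0 isT s) => // i Hi.
    have ib : i < nb_leaves c.
      by rewrite -Htake ltnNge; apply/negP => L; move: Hi; rewrite nth_default.
    rewrite nth_take // in Hi; have := Nhs i Hi; rewrite mem_cat => /orP [//|].
    by move=> /(forest_descs_bounds Wcs); rewrite /first /=; lia.
  have [ts [B1 B2 B3 B4]] : exists ts, [/\ all admissible_nodes ts,
      forest_arrows ts = drop (nb_leaves c) hs, map pebbled ts = cs &
      from_count ts = count (predC balanced) cs].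
    apply: (IHc (s + nb_leaves c)) => //.
    - by move=> i Hi; apply: (IH i.+1).
    - move=> i; rewrite nth_drop => Hi; have := Nhs _ Hi; rewrite mem_cat addnA => /orP [|//].
      by case/(descs_bounds Wc) => _ _; rewrite /first /width /=; lia.
    - by rewrite size_drop Hsz; lia.
  exists (t :: ts); split; rewrite /= ?A1 ?A3 ?B3 //.
    by rewrite /forest_arrows /= A2 -/(forest_arrows ts) B2 cat_take_drop.
  by rewrite /from_count /= A4 -/(from_count ts) B4.
exists (Node (if balanced (PNode k cs) then ToRoot else FromRoot) ts).
have E := node_excess W; have Ssz : size ts = size cs by rewrite -Pts size_map.
have := W; rewrite [wf _]/= -/(balanced (PNode k cs)) => /andP [/andP [K1 K2] _].
have tob : is_to (if balanced (PNode k cs) then ToRoot else FromRoot) = balanced (PNode k cs).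
  by case: ifP.
split; [|exact: Fts| |exact: tob].
  rewrite [admissible_nodes _]/= -/(all admissible_nodes) Ats andbT admissible_incident.
  rewrite tob Cts E Ssz K1 /=.
  move: K2; case: (balanced (PNode k cs)); case: (size cs == 1) => /=; lia.
by rewrite /= tob Pts Cts E addnK.
Qed.

(** For [[:: ToRoot]] the node would have one incoming and one outgoing arrow, so the tree without
    internal node takes its place. *)
Definition corolla (hs : seq heading) : otree :=
  if hs is [:: ToRoot] then Arrow ToRoot else Node ToRoot (map Arrow hs).

Lemma corollaP hs : hs = [:: ToRoot] \/
  (corolla hs = Node ToRoot (map Arrow hs) /\ hs <> [:: ToRoot]).
Proof. by case: hs => [|[] [|h hs]]; [right|left|right|right|right]. Qed.

Lemma top_corolla hs : top_arrow (corolla hs) = ToRoot.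
Proof. by case: (corollaP hs) => [->|[->]]. Qed.

Lemma forest_arrows_map_Arrow hs : forest_arrows (map Arrow hs) = hs.
Proof. by rewrite /forest_arrows; elim: hs => //= h hs ->. Qed.

Lemma leaf_arrows_corolla hs : leaf_arrows (corolla hs) = hs.
Proof. by case: (corollaP hs) => [->|[-> _]] //; apply: forest_arrows_map_Arrow. Qed.

Lemma admissible_corolla hs : 0 < size hs -> admissible_nodes (corolla hs).
Proof.
case: (corollaP hs) => [->|[-> N]] // Hsz; apply/andP; split.
  rewrite admissible_incident size_map Hsz add1n /=.
  case: hs N {Hsz} => [|[] [|]] //.
by elim: {Hsz N} hs.
Qed.

Lemma mem_odescs_corolla s hs i :
  is_to (nth FromRoot hs i) -> (s + i, 1, true) \in odescs s (corolla hs).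
Proof.
case: (corollaP hs) => [->|[-> _]].
  by case: i => [_|[]//]; rewrite addn0 mem_head.
move=> Hi; rewrite odescs_node inE; apply/orP; right.
elim: hs s i Hi => [|h hs IH] s [|i] //= Hi; rewrite mem_cat.
  by rewrite addn0; case: h Hi => // _; rewrite mem_head.
by rewrite -addSnnS -addn1 IH ?orbT.
Qed.

Lemma contracts_to_corolla t : admissible_nodes t -> top_arrow t = ToRoot ->
  contracts t (corolla (leaf_arrows t)).
Proof.
move=> H topt; case: (corollaP (leaf_arrows t)) => [E|[-> N]].
  by rewrite E (one_arrow_tree H E topt); apply: rt_refl.
case: t topt N {H} => [h|h cs] /= -> // _.
have := contracts_corolla.2 cs [::] [::] ToRoot [::].
by rewrite /= !cats0.
Qed.

Definition heading_of (a : io) : heading := if a is Inc then ToRoot else FromRoot.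

Lemma alpha_treeE (hs : seq heading) (alpha : seq io) t :
  alpha = Out :: map from_upper_end hs ->
  alpha_tree alpha t <->
  [/\ admissible_nodes t, top_arrow t = ToRoot & leaf_arrows t = hs].
Proof.
have inj : injective from_upper_end by case; case.
move=> ->; rewrite /alpha_tree /external_arrows; split=> [[[e1 e2] H]|[H -> ->]] //.
by split=> //; [case: (top_arrow t) e1 | apply: inj_map e2].
Qed.

Lemma pebble_tree_pebbled hs t : admissible_nodes t -> top_arrow t = ToRoot ->
  leaf_arrows t = hs -> pebble_tree (size hs) (pebbled t).
Proof.
move=> H topt <-; have [W B] := pebbled_wf H.
by rewrite /pebble_tree all_subtrees_wf W B topt nb_leaves_pebbled eqxx.
Qed.

(** * Faces and normal cones *)

Section Faces.
Import GRing.Theory Num.Theory Order.TTheory.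
Local Open Scope ring_scope.
Local Open Scope classical_set_scope.
Variables (R : realType) (n : nat).
Implicit Types (P F G : set 'rV[R]_n) (c x y : 'rV[R]_n) (vs : seq 'rV[R]_n).

Lemma dotDl c c' x : dot (c + c') x = dot c x + dot c' x.
Proof. by rewrite /dot -big_split; apply: eq_bigr => i _; rewrite mxE mulrDl. Qed.

Lemma dotZl (a : R) c x : dot (a *: c) x = a * dot c x.
Proof. by rewrite /dot mulr_sumr; apply: eq_bigr => i _; rewrite mxE mulrA. Qed.

Lemma dot_sumr c m (a : 'I_m -> R) (v : 'I_m -> 'rV[R]_n) :
  dot c (\sum_k a k *: v k) = \sum_k a k * dot c (v k).
Proof.
rewrite /dot; under eq_bigr => i _ do rewrite summxE mulr_sumr.
rewrite exchange_big; apply: eq_bigr => k _; rewrite mulr_sumr; apply: eq_bigr => i _.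
by rewrite mxE mulrCA.
Qed.

Lemma mem_convex_hull vs (k : 'I_(size vs)) : convex_hull vs (nth 0 vs k).
Proof.
exists (fun i => (i == k)%:R); split; first by move=> i; rewrite ler0n.
  by rewrite (bigD1 k) //= eqxx big1 ?addr0 // => i /negbTE ->.
by rewrite (bigD1 k) //= eqxx scale1r big1 ?addr0 // => i /negbTE ->; rewrite scale0r.
Qed.

Lemma face_subset P F : is_face P F -> F `<=` P.
Proof. by move=> [c [b [_ ->]]] x []. Qed.

Lemma face_of_subset P F G : is_face P F -> is_face P G -> G `<=` F -> is_face F G.
Proof.
move=> HF [c [b [valid ->]]] sub; exists c, b; split.
  by move=> x /(face_subset HF) /valid.
by apply/seteqP; split=> x [Hx e]; split=> //; [apply: sub | apply: face_subset HF _ Hx].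
Qed.

(* A large multiple of the inequality defining [F] is added to the one defining [G]. *)
Lemma face_trans P F G : is_polytope P -> is_face P F -> is_face F G -> is_face P G.
Proof.
move=> [vs ->] [c [b [validF ->]]] [c' [b' [validG ->]]].
pose v k := nth 0 vs (nat_of_ord (n := size vs) k).
(* The ratio of the violation of the second inequality to the slack in the first. The multiple [M]
   exceeds all of these, so the slack [g] of the combined inequality is positive at generators off
   the first face. *)
pose r k := (dot c' (v k) - b') / (b - dot c (v k)).
pose M := 1 + \sum_k `|r k|.
pose g k := M * (b - dot c (v k)) + (b' - dot c' (v k)).
have gP k : 0 <= g k /\ (g k = 0 -> dot c (v k) = b).
  have := validF _ (mem_convex_hull k); rewrite -/(v k) le_eqVlt => /predU1P [e|lt].
    split=> //; rewrite /g e subrr mulr0 add0r subr_ge0.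
    by apply: validG; split=> //; apply: mem_convex_hull.
  suff pos : 0 < g k by split; [exact: ltW | move=> e; rewrite e ltxx in pos].
  have d0 : 0 < b - dot c (v k) by rewrite subr_gt0.
  have rM : r k < M.
    rewrite /M (bigD1 k) //=; have := ler_norm (r k).
    have : 0 <= \sum_(i | i != k) `|r i| by apply: sumr_ge0.
    lra.
  by move: rM; rewrite /r ltr_pdivrMr // /g; lra.
have gapE (a : 'I_(size vs) -> R) (e : 'rV[R]_n) (f : R) : \sum_k a k = 1 ->
    f - dot e (\sum_k a k *: v k) = \sum_k a k * (f - dot e (v k)).
  move=> a1; rewrite dot_sumr; under [RHS]eq_bigr => k _ do rewrite mulrBr.
  by rewrite sumrB -mulr_suml a1 mul1r.
have gE k : M * b + b' - dot (M *: c + c') (v k) = g k.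
  by rewrite dotDl dotZl /g; lra.
exists (M *: c + c'), (M * b + b'); split.
  move=> x [a [a0 a1 ->]]; rewrite -subr_ge0 gapE //.
  by apply: sumr_ge0 => k _; rewrite gE mulr_ge0 ?(gP k).1.
apply/seteqP; split=> x.
  by move=> [[Px e] e']; split=> //; rewrite dotDl dotZl e e'.
move=> [Px e]; have [a [a0 a1 ex]] := Px.
have sum0 : \sum_k a k * g k = 0.
  under eq_bigr => k _ do rewrite -gE.
  by rewrite -gapE // -[\sum_k _]ex e subrr.
(* A point on the combined face puts weight only on generators without slack, and these lie on the
   first face. *)
have all0 k : a k * g k = 0.
  have nonneg i : true -> 0 <= a i * g i by move=> _; rewrite mulr_ge0 ?(gP i).1.
  by have /eqP := sum0; rewrite psumr_eq0 // => /allP /(_ k (mem_index_enum k)) /eqP.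
have cx : dot c x = b.
  apply/esym/eqP; rewrite -subr_eq0 ex [\sum_k _](_ : _ = \sum_k a k *: v k) // gapE //.
  rewrite big1 // => k _; have /eqP := all0 k; rewrite mulf_eq0 => /predU1P [->|/eqP /(gP k).2 ->].
    by rewrite mul0r.
  by rewrite subrr mulr0.
by split=> //; move: e; rewrite dotDl dotZl cx => /addrI.
Qed.

(** A linear form cutting out [G] lies in the normal cone of [G]. If it also lies in that of [G'],
    it is maximal on [G'], whence [G'] is contained in [G]. *)
Lemma normal_cone_subset P G G' : (0 < n)%N -> P `<=` @sum_zero R n ->
  nonempty_faces P G -> nonempty_faces P G' ->
  normal_cone P G `<=` normal_cone P G' <-> G' `<=` G.
Proof.
move=> n0 P0 [[c [b [valid eG]]] [y Gy]] [faceG' _]; split=> [sub x Gx'|sub d [d0 Hd]]; last first.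
  by split=> // x z /sub; apply: Hd.
have Px := face_subset faceG' Gx'.
(* The orthogonal projection of [c] to [sum_zero]; it defines the same form on [P]. *)
pose c0 := c - const_mx ((\sum_i c 0 i) / n%:R).
have dot0 z : P z -> dot c0 z = dot c z.
  move=> /P0 z0; rewrite /dot /c0; under eq_bigr => i _ do rewrite !mxE mulrBl.
  by rewrite sumrB -mulr_sumr z0 mulr0 subr0.
have c00 : sum_zero c0.
  rewrite /sum_zero /c0 /=; under eq_bigr => i _ do rewrite !mxE.
  by rewrite sumrB sumr_const card_ord -[X in _ - X]mulr_natr divfK ?subrr // pnatr_eq0 -lt0n.
have [Py ey] : P y /\ dot c y = b by move: Gy; rewrite eG.
have : normal_cone P G c0.
  split=> // u z; rewrite eG => -[Pu eu] Pz.
  by rewrite !dot0 // eu; apply: valid.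
move=> /sub [_ /(_ x y Gx' Py)]; rewrite !dot0 // ey => le.
by rewrite eG; split=> //; apply/eqP; rewrite eq_le valid.
Qed.
End Faces.

(** * The face realizing the assocoipahedron *)

Local Open Scope classical_set_scope.

Theorem mainTheorem3 (R : realType) (l : nat) (hl : (1 <= l)%N)
    (alpha : l.+1.-tuple io) (halpha : thead alpha = Out)
    (P : set 'rV[R]_(2 * l).-1) (hP : pebble_tree_polytope l P) :
  exists F : set 'rV[R]_(2 * l).-1,
    is_face P F /\
    order_isomorphic
      (nonempty_faces F) (fun G G' : set 'rV[R]_(2 * l).-1 => G' `<=` G)
      [set t : otree | alpha_tree alpha t] contraction_le.
Proof.
have [polyP P0 fanE] := hP.
pose hs := map heading_of (behead alpha).
have alphaE : tval alpha = Out :: map from_upper_end hs.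
  rewrite -halpha /hs -map_comp [in LHS](tuple_eta alpha) /=; congr cons.
  by rewrite -[LHS]map_id; apply: eq_map => -[].
have Hsz : size hs = l by rewrite /hs size_map size_behead size_tuple.
have alphaP t : alpha_tree alpha t <->
    [/\ admissible_nodes t, top_arrow t = ToRoot & leaf_arrows t = hs].
  exact: alpha_treeE alphaE.
have pebP t : alpha_tree alpha t -> pebble_tree l (pebbled t).
  by move=> /alphaP [A B C]; have := pebble_tree_pebbled A B C; rewrite Hsz.
have coneP t t' : alpha_tree alpha t -> alpha_tree alpha t' ->
    (pebble_cone R l (pebbled t) `<=` pebble_cone R l (pebbled t') <->
     contraction_le t t').
  move=> At At'; apply: iff_trans (subset_descs_cone R hl (pebP _ At) (pebP _ At')) _.
  move: At At' => /alphaP [A B C] /alphaP [A' B' C'].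
  rewrite !descs_pebbled //; split=> [|/contracts_odescs [_ _ _]]; last exact.
  by apply: odescs_subset_contracts; rewrite // ?B ?C.
pose t0 := corolla hs.
have At0 : alpha_tree alpha t0.
  apply/alphaP; split; rewrite ?top_corolla ?leaf_arrows_corolla //.
  by apply: admissible_corolla; rewrite Hsz.
have face_of T : pebble_tree l T ->
    exists2 G, nonempty_faces P G & normal_cone P G = pebble_cone R l T.
  move=> HT; have : normal_fan P (pebble_cone R l T) by rewrite fanE; exists T.
  by case=> G HG e; exists G.
have coneNP G G' : nonempty_faces P G -> nonempty_faces P G' ->
    normal_cone P G `<=` normal_cone P G' <-> G' `<=` G.
  by apply: normal_cone_subset => //; lia.
(* The face sought is the one whose normal cone is the cone of the corolla. *)
have [F HF NF] := face_of _ (pebP _ At0).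
have subF G : nonempty_faces F G <-> nonempty_faces P G /\ G `<=` F.
  split=> [[HG G0]|[[HG G0] GF]].
    by split; [split=> //; apply: face_trans HF.1 HG | apply: face_subset HG].
  by split=> //; apply: face_of_subset HF.1 HG GF.
exists F; split; first exact: HF.1.
have exf G : exists t, nonempty_faces F G ->
    alpha_tree alpha t /\ normal_cone P G = pebble_cone R l (pebbled t).
  (* [Arrow ToRoot] is a filler value for sets that are not nonempty faces of [F]. *)
  have [HG|nHG] := pselect (nonempty_faces F G); last by exists (Arrow ToRoot).
  have [PG GF] := (subF G).1 HG.
  have : pebble_tree_fan R l (normal_cone P G) by rewrite -fanE; exists G.
  case=> T HT eT.
  (* As [G] lies in [F], the tree of [G] has all descriptors of the corolla, in particular the
     balanced single leaves that [exists_pebbled] requires. *)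
  have sub : {subset descs 1 (pebbled t0) <= descs 1 T}.
    apply/(subset_descs_cone R hl (pebP _ At0) HT).
    by rewrite -NF eT; apply/(coneNP _ _ HF PG).
  have [/eqP LT W BT] := and3P HT; rewrite all_subtrees_wf in W.
  have [|i Hi|t [A1 A2 A3 A4]] := @exists_pebbled T 1 hs W; first by rewrite Hsz LT.
    apply: sub; rewrite descs_pebbled; last by case/alphaP: At0.
    exact: mem_odescs_corolla.
  exists t => _; rewrite A3 eT; split=> //; apply/alphaP; split=> //.
  by apply: is_to_inj; rewrite A4 BT.
have [f fP] := choice exf.
have monof G G' : nonempty_faces F G -> nonempty_faces F G' ->
    (G' `<=` G <-> contraction_le (f G) (f G')).
  move=> HG HG'; have [A e] := fP G HG; have [A' e'] := fP G' HG'.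
  apply: iff_trans (iff_sym (coneNP _ _ ((subF G).1 HG).1 ((subF G').1 HG').1)) _.
  by rewrite e e'; apply: coneP.
exists f; split; last exact: monof.
split.
- by move=> G /fP [].
- move=> G G' /set_mem HG /set_mem HG' e; apply/seteqP.
  by split; apply/monof => //; rewrite e; apply: rt_refl.
(* Surjectivity: [t] contracts to the corolla, so the face [G] with the cone of [t] lies in [F].
   Then [t] and [f G] have the same cone and coincide by antisymmetry. *)
- move=> t At; have [G PG e] := face_of _ (pebP _ At).
  have HG : nonempty_faces F G.
    apply/subF; split=> //; apply/(coneNP _ _ HF PG); rewrite NF e; apply/coneP => //.
    have [A B C] := (alphaP t).1 At.
    by rewrite /t0 -C; apply: contracts_to_corolla.
  exists G => //; have [A eG] := fP G HG.
  have [le le'] : contraction_le (f G) t /\ contraction_le t (f G).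
    by split; apply/coneP => //; rewrite -eG e.
  move: A At le le' => /alphaP [A B C] /alphaP [A' B' C'].
  rewrite /contraction_le => /contracts_odescs [_ _ _ S] /contracts_odescs [_ _ _ S'].
  by apply: (odescs_antisym A A' _ _ (S 1) (S' 1)); rewrite ?B ?C.
Qed.
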